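(* (Truncated Tucker lemma.) Let $n \ge 2k > 1$ be integers. If $\lambda: \mathcal{B}^n_k \to \{\pm 2k, \dots, \pm n\}$ is antipodal, then there are two elements in $\mathcal{B}^n_k$ that are $k$-complementary with respect to $\lambda$.
   Context: Notation: $[n]=\{1,\dots,n\}$, and $\binom{n}{k}$ denotes the set of $k$-element subsets of $[n]$. The truncated octahedral ball is $$\mathcal{B}^n_k := \Bigl\{(A,B) : A,B \in \tbinom{n}{k}\cup\{\emptyset\},\ A\cap B=\emptyset,\ (A,B)\ne(\emptyset,\emptyset)\Bigr\}.$$ The set $\{\pm 2k,\dots,\pm n\}$ consists of all integers $i$ with $2k\le |i|\le n$. A map $\lambda:\mathcal{B}^n_k\to\{\pm 2k,\dots,\pm n\}$ is antipodal if $\lambda(A,B)=-\lambda(B,A)$ for all $(A,B)\in\mathcal{B}^n_k$. For $A\subseteq[n]$ with $|A|\ge k$, $A_{\le k}$ denotes the set of the $k$ least elements of $A$; also $\emptyset_{\le k}=\emptyset$. For $A_1,A_2\in\binom{n}{k}\cup\{\emptyset\}$, write $A_1\preceq A_2$ iff $(A_1\cup A_2)_{\le k}=A_2$. For $(A_1,B_1),(A_2,B_2)\in\mathcal{B}^n_k$, write $(A_1,B_1)\preceq(A_2,B_2)$ when $A_1\preceq A_2$, $B_1\preceq B_2$, and $A_i\cap B_j=\emptyset$ for all $i,j\in\{1,2\}$. The pairs $(A_1,B_1)$ and $(A_2,B_2)$ are $k$-complementary with respect to an antipodal map $\lambda$ on $\mathcal{B}^n_k$ if $(A_1,B_1)\preceq(A_2,B_2)$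 and $\lambda(A_1,B_1)=-\lambda(A_2,B_2)$. *)

(* Defs.v *)
From mathcomp Require Import all_boot all_order all_algebra.

Set Implicit Arguments.
Unset Strict Implicit.
Unset Printing Implicit Defensive.

(* The ground set {1, ..., n} is 'I_n = {0, ..., n-1} with its usual order: only
   the order of the elements matters below. *)

Definition ksubset0 (n k : nat) (A : {set 'I_n}) : bool :=
  (#|A| == k) || (A == set0).

Definition truncated_ball (n k : nat) : {set {set 'I_n} * {set 'I_n}} :=
  [set p | [&& ksubset0 k p.1, ksubset0 k p.2,
               p.1 :&: p.2 == set0 & p != (set0, set0)]].

(* The k least elements of A: those with fewer than k elements of A strictly
   below them. Meant for #|A| >= k or A = set0. *)
Definition least (n k : nat) (A : {set 'I_n}) : {set 'I_n} :=
  [set i in A | #|[set j in A | (j < i)%N]| < k].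

Definition set_prec (n k : nat) (A1 A2 : {set 'I_n}) : bool :=
  least k (A1 :|: A2) == A2.

Definition ball_prec (n k : nat) (p1 p2 : {set 'I_n} * {set 'I_n}) : bool :=
  [&& set_prec k p1.1 p2.1, set_prec k p1.2 p2.2,
      p1.1 :&: p1.2 == set0, p1.1 :&: p2.2 == set0,
      p2.1 :&: p1.2 == set0 & p2.1 :&: p2.2 == set0].

(* A map from the ball is given by a function on all pairs of sets, of which only
   the values on the ball are ever used. *)
Definition labels_in_range (n k : nat)
    (lambda : {set 'I_n} * {set 'I_n} -> int) : Prop :=
  forall p, p \in truncated_ball n k -> 2 * k <= `|lambda p|%N <= n.

Definition antipodal (n k : nat)
    (lambda : {set 'I_n} * {set 'I_n} -> int) : Prop :=
  forall A B : {set 'I_n}, (A, B) \in truncated_ball n k ->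
    lambda (A, B) = (- lambda (B, A))%R.

Definition k_complementary (n k : nat)
    (lambda : {set 'I_n} * {set 'I_n} -> int)
    (p1 p2 : {set 'I_n} * {set 'I_n}) : Prop :=
  ball_prec k p1 p2 /\ lambda p1 = (- lambda p2)%R.

(* Main.v *)
Require Import Defs.
From mathcomp Require Import all_boot all_order all_algebra.
From HB Require Import structures.
From mathcomp Require Import fingroup perm zify.

(** The statement reduces to the octahedral Tucker lemma: an antipodal labelling
    of the nonzero sign vectors of length n (pairs (A, B) of disjoint sets, not
    both empty) by n - 1 consecutive absolute values and their negatives has two
    comparable vectors with opposite labels.

    Reduction.  Extend lambda to all nonzero sign vectors.  If A or B has at
    least k elements, label (A, B) by lambda (A', B'), where a set of size at
    least k is replaced by its k least elements and a smaller one by the empty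
    set; this truncation turns inclusion into the order of the truncated ball
    ([truncate_prec]).  Otherwise use the label +-(|A| + |B| + 1), of absolute
    value in [2, 2k - 1], with an antipodal choice of sign.  All the absolute
    values lie in [2, n].  Two comparable vectors with opposite labels cannot
    both be small, since they would have equal sizes and hence be equal; they
    cannot be of different kinds, since the absolute values of the two kinds
    are disjoint; so both are large, and their truncations are the
    k-complementary pair.

    Octahedral Tucker lemma.  It follows from a parity theorem of Ky Fan's type.
    Maximal chains of sign vectors are encoded as flags: a permutation, giving
    the order in which the coordinates become nonzero, and the sign of each
    coordinate.  Call a list of labels alternating if, sorted by absolute value,
    it has signs +, -, +, and so on.  The number N_m of flags with alternating
    labels on the first m coordinates is odd for every m.  To pass from m to
    m + 1, take the flags of dimension m + 1 in the upper hemisphere, where the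
    last coordinate is positive, and count modulo 2 the pairs of such a flag and
    one of its facets with alternating labels.
    Counted by flags, a flag contributes 1 exactly when its labels or their
    opposites alternate ([alternates_facets]); by antipodality this adds up to
    N_(m+1).  Counted by facets, every facet interior to the hemisphere lies in
    two flags and cancels ([face_cancel]), and the facets on the equator add up
    to N_m ([last_face]).  Finally, n alternating labels without an opposite
    pair have n distinct absolute values ([alternates_uniq]), which n - 1 values
    do not allow. *)

Set Implicit Arguments.
Unset Strict Implicit.
Unset Printing Implicit Defensive.

Import Order.TTheory GRing.Theory Num.Theory GroupScope.

(** * Alternating lists of labels *)

Fixpoint alternating (s : bool) (b : seq bool) : bool :=
  if b is x :: b' then (x == s) && alternating (~~ s) b' else true.

Definition abs_le : rel int := fun x y => `|x| <= `|y|.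

(** Sorting is by absolute value alone, so that it commutes with negation; the
    order of the entries of L matters only if L contains opposite labels. *)
Definition alternates (L : seq int) : bool :=
  alternating true [seq (0 < x)%R | x <- sort abs_le L].

Lemma abs_le_total : total abs_le.
Proof. by move=> x y; apply: leq_total. Qed.

Lemma abs_le_trans : transitive abs_le.
Proof. by move=> y x z; apply: leq_trans. Qed.

(** This is the coboundary computation behind Fan's theorem, on sign sequences
    only: induction on the list, comparing the first sign with s.  Removing the
    head leaves the tail; removing another entry is a facet of the tail. *)
Lemma alternating_facets (I : eqType) (b : I -> bool) (s : bool) (r : seq I) :
  uniq r -> 0 < size r ->
  \big[addb/false]_(j <- r) alternating s [seq b i | i <- r & i != j]
  = alternating s (map b r) (+) alternating (~~ s) (map b r).
Proof.
elim: r s => [|x r IHr] //= s /andP[xr ur] _.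
rewrite big_cons /= eqxx /=.
have -> : [seq i <- r | i != x] = r.
  by apply/all_filterP/allP => i ir; apply: contraNneq xr => <-.
have -> : \big[addb/false]_(j <- r)
    alternating s [seq b i | i <- (if x != j then x :: [seq i <- r | i != j]
                                   else [seq i <- r | i != j])]
  = (b x == s) && \big[addb/false]_(j <- r)
      alternating (~~ s) [seq b i | i <- r & i != j].
  rewrite big_distrr /=; apply: eq_big_seq => j jr.
  by rewrite (_ : x != j) //=; apply: contraNneq xr => ->.
case: (posnP (size r)) => [/size0nil -> | r_gt0].
  by rewrite big_nil; case: (b x); case: s.
rewrite (IHr (~~ s)) // negbK.
move: (alternating s _) (alternating (~~ s) _) => u v.
by case: (b x) s u v => -[] [] [].
Qed.

Lemma alternating_negb s b :
  alternating s (map negb b) = alternating (~~ s) b.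
Proof. by elim: b s => //= x b IHb s; rewrite IHb; case: x; case: s. Qed.

Lemma alternates_opp (L : seq int) : 0%R \notin L ->
  alternates [seq (- x)%R | x <- L]
  = alternating false [seq (0 < x)%R | x <- sort abs_le L].
Proof.
move=> L0; rewrite /alternates -(alternating_negb true) -map_comp.
have opp_mono : {mono (fun x : int => - x)%R : x y / abs_le x y}.
  by move=> x y; rewrite /abs_le !abszN.
rewrite -(map_sort opp_mono) -map_comp; congr alternating.
apply/eq_in_map => x; rewrite mem_sort /= => xL.
by rewrite oppr_gt0 -leNgt le_eqVlt; case: eqP xL L0 => // ->  ->.
Qed.

(** Sorting is stable, so it commutes with the removal of an entry, and the
    identity for sign sequences transfers to labels. *)
Lemma alternates_facets (I : eqType) (f : I -> int) (r : seq I) :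
  uniq r -> 0 < size r -> {in r, forall i, f i != 0%R} ->
  \big[addb/false]_(j <- r) alternates [seq f i | i <- r & i != j]
  = alternates (map f r) (+) alternates [seq (- f i)%R | i <- r].
Proof.
move=> ur r_gt0 f_neq0; rewrite (map_comp (fun x => - x)%R f) alternates_opp; last first.
  by apply/mapP => -[i /f_neq0 fi0 fi]; rewrite -fi in fi0.
rewrite /alternates !sort_map -map_comp.
rewrite -(@alternating_facets _ (fun i => 0 < f i)%R true) ?sort_uniq ?size_sort //.
rewrite (perm_big (sort (relpre f abs_le) r)) 1?perm_sym ?perm_sort //=.
apply: eq_bigr => j _; rewrite sort_map -map_comp filter_sort //.
  by move=> x y; apply: abs_le_total.
by move=> y x z; apply: abs_le_trans.
Qed.

(** Consecutive entries of the sorted list have different signs, so if their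
    absolute values were equal they would be opposite. *)
Lemma alternates_uniq (L : seq int) :
  alternates L -> {in L, forall x, (- x)%R \notin L} -> uniq (map absz L).
Proof.
move=> altL noL.
have pL : perm_eq (map absz (sort abs_le L)) (map absz L).
  by apply: perm_map; rewrite perm_sort.
rewrite -(perm_uniq pL); apply: (sorted_uniq ltn_trans ltnn).
have noS : {in sort abs_le L &, forall x y, x != - y}%R.
  move=> x y; rewrite !mem_sort => xL yL; apply: contraNneq (noL y yL).
  by move=> <-.
move: altL noS (sort_sorted abs_le_total L); rewrite /alternates.
case: (sort abs_le L) => //= x s /andP[/eqP x_gt0].
rewrite -[X in alternating X]/(~~ true) -x_gt0; elim: s x {x_gt0} => //= y s IHs x /andP[/eqP y_sgn alts] noS.
case/andP=> xy ys; rewrite IHs ?y_sgn //; last first.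
  by move=> u v us vs; apply: noS; rewrite inE ?us ?vs orbT.
rewrite andbT ltn_neqAle [_ <= _]xy andbT.
apply/eqP => abs_xy; have := noS x y; rewrite !inE !eqxx orbT => /(_ isT isT).
lia.
Qed.

(** * Flags of sign vectors *)

(** Since a changes along each orbit of h, the orbits in P have two elements,
    on which g takes the same value. *)
Lemma big_addb_involution (T : finType) (P a g : pred T) (h : T -> T) :
  involutive h -> (forall x, P (h x) = P x) ->
  (forall x, P x -> a (h x) = ~~ a x) -> (forall x, P x -> g (h x) = g x) ->
  \big[addb/false]_(x | P x) g x = false.
Proof.
move=> hK Ph ah gh; rewrite (bigID a) /=.
rewrite [X in _ (+) X](reindex_inj (inv_inj hK)) /=.
have -> : \big[addb/false]_(x | P (h x) && ~~ a (h x)) g (h x)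
        = \big[addb/false]_(x | P x && a x) g x; last by rewrite addbb.
apply: congr_big => // [x | x /andP[]]; rewrite Ph; last by move/gh.
by case Px: (P x) => //=; rewrite ah // negbK.
Qed.

(** The flag (p, s) is the chain of sign vectors whose m-th member has support
    p 0, ..., p (m - 1) and signs s, where true stands for +. *)
Definition flag (n : nat) : Type := ('S_n * {ffun 'I_n -> bool})%type.
HB.instance Definition _ n := Finite.on (flag n).

Section Flags.

Variable n : nat.
Implicit Types (f : flag n) (d : 'I_n).

Definition pos_part f m : {set 'I_n} := [set i | (f.1^-1 i < m) && f.2 i].
Definition neg_part f m : {set 'I_n} := [set i | (f.1^-1 i < m) && ~~ f.2 i].

(** Requiring standard values beyond m, rather than using flags of 'I_m, makes
    a flag of dimension m a flag of dimension m + 1 without any re-indexing. *)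
Definition in_dim (m : nat) f : bool :=
  [forall i : 'I_n, (m <= i) ==> (f.1 i == i) && f.2 i].

Lemma in_dimP m f :
  reflect (forall i : 'I_n, m <= i -> f.1 i = i /\ f.2 i) (in_dim m f).
Proof.
apply: (iffP forallP) => h i; first by move=> mi; have /implyP/(_ mi)/andP[/eqP] := h i.
by apply/implyP => /h[-> ->]; rewrite eqxx.
Qed.

Lemma parts_disjoint f m : pos_part f m :&: neg_part f m = set0.
Proof. by apply/setP => i; rewrite !inE; case: (f.2 i); rewrite !(andbT, andbF). Qed.

Lemma parts_neq0 f m : m < n -> pos_part f m.+1 :|: neg_part f m.+1 != set0.
Proof.
move=> mn; apply/set0Pn; exists (f.1 (Ordinal mn)).
by rewrite !inE permK /= ltnSn; case: (f.2 _).
Qed.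

Lemma parts_mono f m1 m2 : m1 <= m2 ->
  (pos_part f m1 \subset pos_part f m2) /\ (neg_part f m1 \subset neg_part f m2).
Proof.
move=> le12; split; apply/subsetP => i; rewrite !inE => /andP[lti ->];
  by rewrite (leq_trans lti).
Qed.

Definition flag_swap (x y : 'I_n) f : flag n := (tperm x y * f.1, f.2).

Lemma flag_swapK x y : involutive (flag_swap x y).
Proof. by case=> p s; rewrite /flag_swap /= mulgA tperm2 mul1g. Qed.

(** For adjacent positions x and y the hypothesis fails for one m only, so that
    exchanging them changes a single member of the chain. *)
Lemma parts_swap (x y : 'I_n) f m : (x < m) = (y < m) ->
  pos_part (flag_swap x y f) m = pos_part f m /\
  neg_part (flag_swap x y f) m = neg_part f m.
Proof.
move=> xym; split; apply/setP => i; rewrite !inE /= invMg tpermV permM;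
  by case: tpermP => [-> | -> | //]; rewrite xym.
Qed.

Lemma in_dim_swap (x y : 'I_n) m f : x < m -> y < m ->
  in_dim m (flag_swap x y f) = in_dim m f.
Proof.
move=> xm ym; apply: eq_forallb => i /=; case: leqP => //= mi.
rewrite permM tpermD //; apply/eqP => e; first by rewrite -e leqNgt xm in mi.
by rewrite -e leqNgt ym in mi.
Qed.

(** Reverses the signs on a set D that may depend on the permutation: all of
    the first coordinates for the antipodal map, the coordinate that appears
    last for the exchange of two flags with a common facet. *)
Definition flag_flip (D : 'S_n -> pred 'I_n) f : flag n :=
  (f.1, [ffun i => D f.1 i (+) f.2 i]).

Lemma flag_flipK D : involutive (flag_flip D).
Proof.
by case=> p s; congr pair; apply/ffunP => i; rewrite !ffunE /= addKb.
Qed.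

Lemma in_dim_flip D m f : (forall i : 'I_n, m <= i -> ~~ D f.1 i) ->
  in_dim m (flag_flip D f) = in_dim m f.
Proof.
move=> Dm; apply: eq_forallb => i /=; case: leqP => //= mi.
by rewrite ffunE (negPf (Dm i mi)).
Qed.

Lemma in_dim_bound m f (i : 'I_n) j : j <= m -> in_dim m f ->
  f.1^-1 i < j -> i < m.
Proof.
move=> jm /in_dimP fm; apply: contraLR; rewrite -!leqNgt => mi.
by have [e _] := fm i mi; rewrite -{1}e permK (leq_trans jm).
Qed.

(** * The parity of the number of alternating flags *)

Section Labels.

Variable L : {set 'I_n} -> {set 'I_n} -> int.

Definition label f m : int := L (pos_part f m.+1) (neg_part f m.+1).

Definition alternating_flags m : bool :=
  \big[addb/false]_(f | in_dim m f) alternates [seq label f j | j <- iota 0 m].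

Hypothesis L_neq0 : forall A B : {set 'I_n}, A :&: B = set0 ->
  A :|: B != set0 -> L A B != 0%R.
Hypothesis L_anti : forall A B : {set 'I_n}, A :&: B = set0 ->
  A :|: B != set0 -> L B A = (- L A B)%R.

Lemma label_neq0 f m : m < n -> label f m != 0%R.
Proof. by move=> mn; apply: L_neq0; rewrite ?parts_disjoint ?parts_neq0. Qed.

(* The facet of the flag f of dimension d + 1 omits its j-th member. *)
Let face d j f := alternates [seq label f i | i <- iota 0 d.+1 & i != j].

(* The hemisphere where the last coordinate of the full-support vector is +. *)
Let upper d f := in_dim d.+1 f && f.2 d.

(** The flags of the lower hemisphere are the antipodes of those of the upper
    one and have opposite labels, so that each upper flag accounts for the two
    terms of [alternates_facets]. *)
Lemma alternating_flags_upper d :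
  alternating_flags d.+1 =
  \big[addb/false]_(f | upper d f) \big[addb/false]_(j <- iota 0 d.+1) face d j f.
Proof.
rewrite /alternating_flags (bigID (fun f => f.2 d)) /=.
pose D (_ : 'S_n) (i : 'I_n) := i <= d.
rewrite [X in _ (+) X](reindex_inj (inv_inj (flag_flipK D))) /=.
have dim_flip f : in_dim d.+1 (flag_flip D f) = in_dim d.+1 f.
  by apply: in_dim_flip => i; rewrite /D -ltnNge.
have -> : \big[addb/false]_(f | in_dim d.+1 (flag_flip D f) && ~~ (flag_flip D f).2 d)
    alternates [seq label (flag_flip D f) j | j <- iota 0 d.+1]
  = \big[addb/false]_(f | upper d f)
    alternates [seq (- label f j)%R | j <- iota 0 d.+1].
  apply: congr_big => // [f | f].
    by rewrite dim_flip /upper ffunE /D leqnn negbK.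
  rewrite dim_flip => /andP[fd _]; congr alternates.
  apply/eq_in_map => j; rewrite mem_iota add0n => jd.
  rewrite /label -L_anti ?parts_disjoint ?parts_neq0 ?(leq_trans jd) //.
  by congr L; apply/setP => i; rewrite !inE ffunE /D;
     case: ltnP => //= /(in_dim_bound jd fd); rewrite ltnS => -> //=; rewrite negbK.
rewrite -big_split; apply: eq_bigr => f _.
rewrite /face alternates_facets ?(iota_uniq 0 d.+1) // => j; rewrite -[_ :: _]/(iota 0 d.+1).
by rewrite mem_iota => jd; apply: label_neq0; apply: leq_trans jd (ltn_ord d).
Qed.

(** The flags containing a facet that omits a member other than the last one
    come in pairs, exchanged by a transposition of adjacent positions. *)
Lemma face_cancel d j : j < d ->
  \big[addb/false]_(f | upper d f) face d j f = false.
Proof.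
move=> jd; have jn : j < n by apply: ltn_trans jd _.
have j1n : j.+1 < n by apply: leq_ltn_trans jd _.
pose x := Ordinal jn; pose y := Ordinal j1n.
apply: (big_addb_involution (a := fun f => f.1 x < f.1 y) (flag_swapK x y)).
- by move=> f; rewrite /upper in_dim_swap //= ltnS // ltnW.
- move=> f _ /=; rewrite !permM tpermL tpermR ltn_neqAle -leqNgt.
  suff -> : (f.1 y != f.1 x :> nat) by [].
  by rewrite (inj_eq val_inj) (inj_eq perm_inj) -(inj_eq val_inj) /= neq_ltn ltnSn orbT.
move=> f _; congr alternates; apply/eq_in_map => i.
rewrite mem_filter => /andP[ij _]; rewrite /label.
have [|-> -> //] := @parts_swap x y f i.+1.
by rewrite /= !ltnS (leq_eqVlt j) eq_sym (negPf ij).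
Qed.

(** Omitting the last member forgets the sign of the coordinate that appears
    last.  If this is not coordinate d, both signs are allowed in the upper
    hemisphere and the two flags cancel; otherwise the facet is a flag of the
    equator. *)
Lemma last_face d :
  \big[addb/false]_(f | upper d f) face d d f = alternating_flags d.
Proof.
have face_iota f : face d d f = alternates [seq label f i | i <- iota 0 d].
  congr (alternates (map _ _)); rewrite -addn1 iotaD add0n filter_cat /= eqxx cats0.
  by apply/all_filterP/allP => i; rewrite mem_iota => /ltn_eqF ->.
rewrite (bigID (fun f => f.1 d == d)) /= [X in _ (+) X]
  (@big_addb_involution _ (fun f => upper d f && (f.1 d != d)) (fun f => f.2 (f.1 d))
     _ (flag_flip (fun p => pred1 (p d)))) ?addbF.
- apply: congr_big => // f; apply/andP/in_dimP => [[/andP[/in_dimP fd ud] /eqP pd] i | fd].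
    by rewrite leq_eqVlt => /predU1P[/val_inj <- | /fd].
  have [pd ud] := fd d (leqnn d); rewrite /upper ud pd eqxx andbT.
  by split=> //; apply/in_dimP => i /ltnW/fd.
- exact: flag_flipK.
- move=> f; apply: andb_id2r => /= pd; rewrite /upper ffunE /= eq_sym (negPf pd) /=.
  congr andb.
  have bound g : in_dim d.+1 g -> g.1 d <= d.
    by move=> gd; have := @in_dim_bound d.+1 g (g.1 d) _ (leqnn _) gd; rewrite permK; apply.
  have flip_dim : f.1 d <= d ->
      in_dim d.+1 (flag_flip (fun p => pred1 (p d)) f) = in_dim d.+1 f.
    move=> pd_le; apply: in_dim_flip => i di /=.
    by apply: contraTneq di => ->; rewrite -leqNgt.
  by apply/idP/idP => fd; [rewrite -flip_dim | rewrite flip_dim] => //; exact: bound fd.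
- by move=> f _; rewrite /= ffunE /= eqxx.
move=> f /andP[_ pd]; rewrite !face_iota; congr alternates.
apply/eq_in_map => j; rewrite mem_iota => /= jd.
by rewrite /label; congr L; apply/setP => i; rewrite !inE ffunE /=;
   case: eqP => //= ->; rewrite permK ltnS leqNgt jd.
Qed.

Lemma alternating_flagsS d : alternating_flags d.+1 = alternating_flags d.
Proof.
rewrite alternating_flags_upper exchange_big /=.
rewrite -[_ :: _]/(index_iota 0 d.+1) big_nat_recr //= last_face big_nat big1 //.
by move=> j /andP[_ jd]; apply: face_cancel.
Qed.

Lemma alternating_flags0 : alternating_flags 0.
Proof.
rewrite /alternating_flags (bigD1 (1, [ffun=> true])) /=; last first.
  by apply/in_dimP => i _; rewrite perm1 ffunE.
rewrite big1 // => -[p s] /andP[/in_dimP ps /eqP[]]; congr pair.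
  by apply/permP => i; have [-> _] := ps i isT; rewrite perm1.
by apply/ffunP => i; have [_ ->] := ps i isT; rewrite ffunE.
Qed.

Theorem ex_alternating_flag :
  exists f, alternates [seq label f j | j <- iota 0 n].
Proof.
have /negP alt_n : alternating_flags n != false.
  suff odd_m m : m <= n -> alternating_flags m by rewrite odd_m.
  elim: m => [|m IHm] mn; first exact: alternating_flags0.
  by rewrite (alternating_flagsS (Ordinal mn)) IHm // ltnW.
apply/existsP; apply: contra_notT alt_n => /existsPn noalt.
by rewrite /alternating_flags big1 // => f _; apply/negbTE.
Qed.

End Labels.
End Flags.

(** * The octahedral Tucker lemma *)

Theorem octahedral_tucker (n m : nat) (L : {set 'I_n} -> {set 'I_n} -> int) :
  0 < n ->
  (forall A B : {set 'I_n}, A :&: B = set0 -> A :|: B != set0 ->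
     m < `|L A B| < m + n) ->
  (forall A B : {set 'I_n}, A :&: B = set0 -> A :|: B != set0 ->
     L B A = (- L A B)%R) ->
  exists A1 B1 A2 B2 : {set 'I_n},
    [/\ A1 \subset A2, B1 \subset B2, A2 :&: B2 = set0, A1 :|: B1 != set0
      & L A1 B1 = (- L A2 B2)%R].
Proof.
move=> n_gt0 rangeL antiL.
have L_neq0 (A B : {set 'I_n}) : A :&: B = set0 -> A :|: B != set0 -> L A B != 0%R.
  by move=> AB0 AB; have := rangeL A B AB0 AB; case: eqP => // ->; rewrite ltn0.
have [f altf] := ex_alternating_flag L_neq0 antiL.
set ls := [seq _ | _ <- _] in altf.
have [/hasP[_ /mapP[i i_n ->] /mapP[j j_n ij]] | no_opp] :=
  boolP (has (fun x => (- x)%R \in ls) ls).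
  rewrite !mem_iota !add0n in i_n j_n.
  have [le_ij | lt_ji] := leqP i j.
    have [posij negij] := @parts_mono _ f i.+1 j.+1 le_ij.
    exists (pos_part f i.+1), (neg_part f i.+1), (pos_part f j.+1), (neg_part f j.+1).
    by split; rewrite ?parts_disjoint ?parts_neq0 // -[RHS]/(- label L f j)%R -ij opprK.
  have [posji negji] := @parts_mono _ f j.+1 i.+1 (ltnW lt_ji).
  exists (pos_part f j.+1), (neg_part f j.+1), (pos_part f i.+1), (neg_part f i.+1).
  by split; rewrite ?parts_disjoint ?parts_neq0.
have /uniq_leq_size : uniq (map absz ls).
  by apply: alternates_uniq => // x xL; apply: contra no_opp => ?; apply/hasP; exists x.
move/(_ (iota m.+1 n.-1)); rewrite !size_map !size_iota => le_n.
(* All absolute values are among the n - 1 integers strictly between m and m + n. *)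
suff: n <= n.-1 by rewrite leqNgt prednK // leqnn.
apply: le_n => x /mapP[y /mapP[j j_n ->] ->]; rewrite mem_iota in j_n.
have := rangeL _ _ (parts_disjoint f j.+1) (parts_neq0 f j_n).
by rewrite mem_iota -/(label L f j); lia.
Qed.

(** * Truncation to the k least elements *)

Section Truncation.

Variables n k : nat.
Implicit Types A B C : {set 'I_n}.

Lemma least_sub A : least k A \subset A.
Proof. by apply/subsetP => i; rewrite inE => /andP[]. Qed.

(** The number of elements of A below i is an injective function of i in A,
    with values 0, ..., |A| - 1; the k least elements are those of value < k. *)
Lemma card_least A : k <= #|A| -> #|least k A| = k.
Proof.
move=> kA; pose rank (i : 'I_n) := #|[set j in A | (j < i)%N]|.
have rank_lt (i j : 'I_n) : i \in A -> i < j -> rank i < rank j.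
  move=> iA ij; apply: proper_card; apply/properP; split.
    by apply/subsetP => l; rewrite !inE => /andP[-> /= li]; apply: ltn_trans li ij.
  by exists i; rewrite !inE iA ?ij ?ltnn.
have rank_inj : {in A &, injective rank}.
  move=> i j iA jA e; apply/val_inj/eqP; rewrite /= -[_ == _]negbK neq_ltn.
  by apply/negP => /orP[] /rank_lt; [move/(_ iA) | move/(_ jA)]; rewrite e ltnn.
have ranks : perm_eq (map rank (enum A)) (iota 0 #|A|).
  have ru : uniq (map rank (enum A)).
    by rewrite map_inj_in_uniq ?enum_uniq // => i j; rewrite !mem_enum; apply: rank_inj.
  have rs : {subset map rank (enum A) <= iota 0 #|A|}.
    move=> r /mapP[i]; rewrite mem_enum mem_iota add0n => iA ->.
    apply: proper_card; apply/properP; split.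
      by apply/subsetP => l; rewrite inE => /andP[].
    by exists i => //; rewrite inE ltnn andbF.
  apply: (uniq_perm ru (iota_uniq _ _)).
  by apply: (uniq_min_size ru rs _).2; rewrite size_map size_iota -cardE.
have -> : #|least k A| = count (fun r => r < k) (map rank (enum A)).
  rewrite count_map -sum1_card -sum1_count big_filter_cond /=.
  by apply: eq_bigl => i; rewrite inE.
rewrite (seq.permP ranks) -(subnKC kA) iotaD count_cat add0n.
rewrite (eq_in_count (a2 := predT)) ?count_predT ?size_iota; last first.
  by move=> i; rewrite mem_iota => /= ->.
rewrite (eq_in_count (a2 := pred0)) ?count_pred0 ?addn0 //.
by move=> i; rewrite mem_iota => /andP[ki _]; rewrite /= ltnNge ki.
Qed.

(** If i were in C but not among the k least elements of A, these would all be
    below i, so that i would have at least k elements of C below it. *)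
Lemma least_between A C :
  k <= #|A| -> least k A \subset C -> C \subset A -> least k C = least k A.
Proof.
move=> kA lC CA.
have sub_below i : [set j in C | (j < i)%N] \subset [set j in A | (j < i)%N].
  by apply/subsetP => j; rewrite !inE => /andP[/(subsetP CA) -> ->].
apply/setP => i; apply/idP/idP => il; last first.
  rewrite inE (subsetP lC) //=; apply: leq_ltn_trans (subset_leq_card (sub_below i)) _.
  by move: il; rewrite inE => /andP[].
move: il; rewrite !inE => /andP[iC ik]; rewrite (subsetP CA) //=.
rewrite ltnNge; apply: contraL ik => ki; rewrite -leqNgt -{1}(card_least kA).
apply: subset_leq_card; apply/subsetP => j jl; rewrite inE (subsetP lC) //=.
rewrite ltnNge; apply/negP => ij; move: jl; rewrite inE => /andP[_].
rewrite ltnNge (leq_trans ki) //; apply: subset_leq_card.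
by apply/subsetP => l; rewrite !inE => /andP[-> li]; apply: leq_trans li ij.
Qed.

Definition truncate A : {set 'I_n} := if k <= #|A| then least k A else set0.

Lemma truncate_sub A : truncate A \subset A.
Proof. by rewrite /truncate; case: ifP; rewrite ?least_sub ?sub0set. Qed.

Lemma truncate_ksubset0 A : ksubset0 k (truncate A).
Proof.
by rewrite /ksubset0 /truncate; case: ifP => [/card_least -> | _]; rewrite eqxx ?orbT.
Qed.

(** The union of the truncations lies between the k least elements of A2 and
    A2, unless A2 has fewer than k elements and both truncations are empty. *)
Lemma truncate_prec A1 A2 : A1 \subset A2 -> set_prec k (truncate A1) (truncate A2).
Proof.
move=> sA; rewrite /set_prec [truncate A2]/truncate; case: leqP => [kA2 | A2k].
  rewrite (least_between kA2) ?subsetUr // subUset least_sub andbT.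
  exact: subset_trans (truncate_sub _) sA.
rewrite /truncate leqNgt (leq_ltn_trans (subset_leq_card sA) A2k) setU0 /=.
by rewrite -subset0 least_sub.
Qed.

Lemma truncate_ball A B : 0 < k -> A :&: B = set0 -> (k <= #|A|) || (k <= #|B|) ->
  (truncate A, truncate B) \in truncated_ball n k.
Proof.
move=> k_gt0 AB0 big; rewrite inE /= !truncate_ksubset0 /=; apply/andP; split.
  by rewrite -subset0 -AB0 setISS ?truncate_sub.
have trunc_neq0 C : k <= #|C| -> truncate C != set0.
  by move=> kC; rewrite -card_gt0 /truncate kC card_least.
by apply/eqP => -[A0 B0]; case/orP: big => /trunc_neq0; rewrite ?A0 ?B0 eqxx.
Qed.

End Truncation.

(** * The truncated Tucker lemma *)

(** The coordinate whose sign is taken depends on the support only, which makes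
    the choice antipodal. *)
Definition pick_sign (T : finType) (A B : {set T}) : int :=
  if [pick x in A :|: B] is Some x then (-1) ^+ (x \in B) else 1.

Lemma pick_sign_anti (T : finType) (A B : {set T}) :
  A :&: B = set0 -> A :|: B != set0 -> pick_sign B A = (- pick_sign A B)%R.
Proof.
move=> AB0 /set0Pn[y yAB]; rewrite /pick_sign setUC.
case: pickP => [x | /(_ y)]; last by rewrite yAB.
have /setP/(_ x) := AB0; rewrite !inE.
by case: (x \in A); case: (x \in B).
Qed.

Lemma abs_pick_sign (T : finType) (A B : {set T}) : `|pick_sign A B|%N = 1%N.
Proof. by rewrite /pick_sign; case: pickP => [x _ | //]; case: (x \in B). Qed.

Theorem theorem16 (n k : nat) (hn : 2 * k <= n) (hk : 1 < 2 * k)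
    (lambda : {set 'I_n} * {set 'I_n} -> int)
    (hrange : labels_in_range k lambda) (hanti : antipodal k lambda) :
  exists p1 p2 : {set 'I_n} * {set 'I_n},
    [/\ p1 \in truncated_ball n k, p2 \in truncated_ball n k
      & k_complementary k lambda p1 p2].
Proof.
have k_gt0 : 0 < k by lia.
pose small (A B : {set 'I_n}) := (#|A| < k) && (#|B| < k).
pose L (A B : {set 'I_n}) : int := if small A B
  then (pick_sign A B * (#|A| + #|B|).+1%:Z)%R
  else lambda (truncate k A, truncate k B).
have smallC A B : small B A = small A B by rewrite /small andbC.
have absL_small A B : small A B -> `|L A B| = (#|A| + #|B|).+1.
  by rewrite /L => ->; rewrite abszM abs_pick_sign mul1n.
have absL_big A B : A :&: B = set0 -> ~~ small A B -> 2 * k <= `|L A B| <= n.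
  move=> AB0 big; rewrite /L (negPf big); apply: hrange.
  by apply: truncate_ball => //; rewrite /small negb_and -!leqNgt in big.
have L_small_lt A B : small A B -> `|L A B| < 2 * k.
  by move=> sAB; rewrite absL_small //; case/andP: sAB; lia.
(* The successor in the small labels keeps them adjacent to the range of lambda,
   so that all absolute values lie strictly between 1 and 1 + n. *)
have [|A B AB0 ABn0|A B AB0 ABn0|] := @octahedral_tucker n 1 L.
- by lia.
- have [sAB | /(absL_big _ _ AB0)] := boolP (small A B); last by lia.
  have := L_small_lt A B sAB; rewrite absL_small //.
  have [cardU _] := leq_card_setU A B; rewrite -card_gt0 in ABn0; lia.
- rewrite /L smallC; case sAB: (small A B).
    by rewrite pick_sign_anti // addnC mulNr.
  apply: hanti; apply: truncate_ball; rewrite // 1?setIC //.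
  by move/negbT: sAB; rewrite /small negb_and -!leqNgt orbC.
move=> A1 [B1 [A2 [B2 [sA sB AB2 AB1 eqL]]]].
have AB1d : A1 :&: B1 = set0 by apply/eqP; rewrite -subset0 -AB2 setISS.
have eq_abs : `|L A1 B1| = `|L A2 B2| by rewrite eqL abszN.
have cA := subset_leq_card sA; have cB := subset_leq_card sB.
have [s2 | b2] := boolP (small A2 B2).
  have s1 : small A1 B1.
    by case/andP: s2 => A2k B2k; rewrite /small (leq_ltn_trans cA) // (leq_ltn_trans cB).
  have eA : A1 = A2.
    by apply/eqP; rewrite eqEcard sA; move: eq_abs; rewrite !absL_small //; lia.
  have eB : B1 = B2.
    by apply/eqP; rewrite eqEcard sB; move: eq_abs; rewrite !absL_small //; lia.
  by have := absL_small _ _ s1; move: eqL; rewrite eA eB; lia.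
have b1 : ~~ small A1 B1.
  apply/negP => /L_small_lt; have := absL_big _ _ AB2 b2; lia.
exists (truncate k A1, truncate k B1), (truncate k A2, truncate k B2).
have bigE A B : ~~ small A B -> (k <= #|A|) || (k <= #|B|).
  by rewrite /small negb_and -!leqNgt.
split; [by apply: truncate_ball => //; apply: bigE..|].
split; last by move: eqL; rewrite /L (negPf b1) (negPf b2).
have disj (A B : {set 'I_n}) : A \subset A2 -> B \subset B2 ->
    truncate k A :&: truncate k B == set0.
  move=> sA2 sB2; rewrite -subset0 -AB2 setISS //.
    exact: subset_trans (truncate_sub _ _) sA2.
  exact: subset_trans (truncate_sub _ _) sB2.
by rewrite /ball_prec /= !truncate_prec // !disj.
Qed.
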